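(* Let $d\ge1$, $\nu>0$, $\gamma>0$, and let $K$ be a random variable with $\Pr\{K=k\}=\alpha_k^{(\nu,\gamma)}$, $k=0,1,\dots$. Then $\sum_{k=0}^\infty\alpha_k^{(\nu,\gamma)}=1$; if $\nu>1$ then $E K=\frac{d\gamma^2}{2\nu-2}$; and if $\nu>2$ then \[ \operatorname{Var}(K)=\frac{d\gamma^2}{2(\nu-1)}\left(1+\frac{\gamma^2}{2}\,\frac{d+2(\nu-1)}{(\nu-1)(\nu-2)}\right). \]
   Context: $\alpha_k^{(\nu,\gamma)}=\frac{\Gamma(k+\frac d2)}{k!\,\Gamma(\frac d2)\Gamma(\nu)}\gamma^{2k}\int_0^{\infty}e^{-a}a^{\nu+\frac d2-1}(a+\gamma^2)^{-k-\frac d2}\,da$. *)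

(* Defs.v *)
From HB Require Import structures.
From mathcomp Require Import all_boot all_order all_algebra.
From mathcomp Require Import all_classical all_reals all_analysis.
Set Implicit Arguments. Unset Strict Implicit. Unset Printing Implicit Defensive.
Import Order.TTheory GRing.Theory Num.Theory numFieldNormedType.Exports.
Local Open Scope classical_set_scope.
Local Open Scope ring_scope.

Definition Gamma {R : realType} (x : R) : R :=
  Rintegral (@lebesgue_measure R) `]0, +oo[%classic
    (fun t => powR t (x - 1) * expR (- t)).

Definition alpha {R : realType} (d : nat) (nu gam : R) (k : nat) : R :=
  Gamma (k%:R + d%:R / 2) / ((k`!)%:R * Gamma (d%:R / 2) * Gamma nu)
  * gam ^+ (2 * k)
  * Rintegral (@lebesgue_measure R) `]0, +oo[%classic
      (fun a => expR (- a) * powR a (nu + d%:R / 2 - 1)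
                * powR (a + gam ^+ 2) (- (k%:R + d%:R / 2))).

(* Main.v *)
Require Import Defs.
From HB Require Import structures.
From mathcomp Require Import all_boot all_order all_algebra.
From mathcomp Require Import all_classical all_reals all_analysis.
From mathcomp Require Import measurable_realfun ring lra.
Import Order.TTheory GRing.Theory Num.Theory numFieldNormedType.Exports.
Local Open Scope classical_set_scope.
Local Open Scope ring_scope.

(* Writing p = d/2 and g = gam^2, the weights are mixtures over a of the
   negative binomial weights (p)_k/k! (a/(a+g))^p (g/(a+g))^k against the
   Gamma(nu) density, so monotone convergence reduces [sum_k alpha_k = 1] to the
   negative binomial series.  The moments need no further analysis: since
   Gamma(s+1) = s Gamma(s),
     (k+1) alpha_(k+1)(d, nu) = p g / (nu - 1) * alpha_k(d + 2, nu - 1),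
   so the mean and the second factorial moment are obtained by shifting the
   series [sum_k alpha_k = 1] for the parameters (d + 2j, nu - j). *)

(** * Exhaustion of the positive half line by compact intervals, and scaling of integrals *)

Lemma itv0y_bigcup {R : realType} (c : R) : 0 < c ->
  `]0, +oo[%classic = \bigcup_n `[c / n.+2%:R, c * n.+2%:R]%classic.
Proof.
move=> c0; apply/seteqP; split => x /=.
- rewrite in_itv/= andbT => x0.
  (* By the Archimedean property this index exceeds both c/x and x/c, which are the two bounds
     needed for x to lie in the interval. *)
  exists (Num.bound (c / x) + Num.bound (x / c))%N => //=.
  have h1 : c / x < (Num.bound (c / x))%:R.
    by rewrite archi_boundP// divr_ge0// ltW.
  have h2 : x / c < (Num.bound (x / c))%:R.
    by rewrite archi_boundP// divr_ge0// ltW.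
  rewrite in_itv/=; apply/andP; split.
    rewrite ler_pdivrMr// mulrC -ler_pdivrMr//; apply: (le_trans (ltW h1)).
    by rewrite ler_nat -addn2 -addnA leq_addr.
  rewrite mulrC -ler_pdivrMr//; apply: (le_trans (ltW h2)).
  by rewrite ler_nat -addn2 addnAC leq_addl.
- move=> [n _] /=; rewrite !in_itv/= andbT => /andP[+ _].
  by apply: lt_le_trans; rewrite divr_gt0.
Qed.

(** Monotone convergence along the exhausting intervals. It carries identities proved on compact
    intervals (substitution, integration by parts) over to the open half line, where a function may
    be singular at 0. Starting at n+2 makes 1/(n+2) < n+2 strict for every n. *)
Lemma cvg_integral_itv0y {R : realType} (c : R) (f : R -> \bar R) : 0 < c ->
  measurable_fun `](0 : R), +oo[ f ->
  (forall x, 0 < x -> (0 <= f x)%E) ->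
  (\int[@lebesgue_measure R]_(x in `[(c / n.+2%:R)%R, (c * n.+2%:R)%R]) f x)%E
    @[n --> \oo] --> (\int[@lebesgue_measure R]_(x in `]0%R, +oo[) f x)%E.
Proof.
move=> c0 mf f0; rewrite (itv0y_bigcup _ c0).
have sub n : `[c / n.+2%:R, c * n.+2%:R]%classic `<=` `]0, +oo[%classic.
  rewrite (itv0y_bigcup _ c0) => x /= xn; by exists n.
apply: ge0_nondecreasing_set_cvg_integral.
- move=> m n mn; rewrite subsetEset => x /=; rewrite !in_itv/= => /andP[h1 h2].
  apply/andP; split.
    apply: le_trans h1; rewrite ler_pM2l// lef_pV2 ?posrE ?ltr0n//.
    by rewrite ler_nat.
  by apply: (le_trans h2); rewrite ler_pM2l// ler_nat.
- by [].
- by move=> n; apply: measurable_funS mf.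
- by move=> n x /sub; rewrite /= in_itv/= andbT => /f0.
Qed.

(** Linear substitution on compact intervals followed by a passage to the limit. No integrability is
    assumed: both sides may be infinite. *)
Lemma ge0_integral_itv0y_scale {R : realType} (c : R) (G : R -> R) : 0 < c ->
  {in `]0, +oo[, continuous G} -> (forall x, 0 < x -> 0 <= G x) ->
  (\int[@lebesgue_measure R]_(x in `]0%R, +oo[) (G x)%:E =
   c%:E * \int[@lebesgue_measure R]_(x in `]0%R, +oo[) (G (c * x)%R)%:E)%E.
Proof.
move=> c0 cG G0.
have mG : measurable_fun `](0 : R), +oo[ G.
  by apply: open_continuous_measurable_fun => // x /set_mem; apply: cG.
have cMc : {in `]0, +oo[, continuous (fun x => G (c * x))}.
  move=> x; rewrite in_itv/= andbT => x0.
  apply: (@continuous_comp _ _ _ (fun x => c * x) G).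
    exact: mulrl_continuous.
  by apply: cG; rewrite in_itv/= andbT mulr_gt0.
have mGc : measurable_fun `](0 : R), +oo[ (fun x => G (c * x)).
  by apply: open_continuous_measurable_fun => // x /set_mem; apply: cMc.
rewrite -ge0_integralZl_EFin//=; last 3 first.
- move=> x; rewrite in_itv/= andbT => x0.
  by rewrite lee_fin G0// mulr_gt0.
- exact/measurable_EFinP.
- exact: ltW.
have h1 := cvg_integral_itv0y _ (fun x => (G x)%:E) c0 _ _.
have h2 := cvg_integral_itv0y _ (fun x => (c%:E * (G (c * x)%R)%:E)%E) (@ltr01 R) _ _.
apply: (cvg_unique (@ereal_hausdorff R) (h1 _ _) _).
- exact/measurable_EFinP.
- by move=> x x0; rewrite lee_fin G0.
(* Multiplication by c maps [1/(n+2), n+2] onto [c/(n+2), c(n+2)], so the two sequences of integrals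
   agree term by term and their limits coincide. *)
have -> : (fun n => \int[@lebesgue_measure R]_(x in
      `[(c / n.+2%:R)%R, (c * n.+2%:R)%R]) (G x)%:E)%E =
    (fun n => \int[@lebesgue_measure R]_(x in
      `[(1 / n.+2%:R)%R, (1 * n.+2%:R)%R]) (c%:E * (G (c * x)%R)%:E))%E.
  apply/funext => n.
  have n0 : (0 : R) < 1 / n.+2%:R by rewrite divr_gt0.
  have n1 : 1 / n.+2%:R < 1 * n.+2%:R :> R.
    by rewrite !mul1r (@lt_trans _ _ 1) ?invf_lt1 ?ltr1n.
  have D : (fun x : R => c * x)^`()%classic = fun=> c.
    by apply/funext => x; rewrite derive1E deriveM// derive_val/=
      derive_cst scaler0 addr0
      /GRing.scale/= mulr1.
  have := @integration_by_substitution_increasing R (fun x => c * x) G _ _ (ltW n1).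
  rewrite !mulrA !mulr1 => ->.
  - apply: eq_integral => x _ /=; rewrite -EFinM; congr EFin.
    by rewrite fctE /= D mulrC.
  - by move=> x y _ _ xy /=; rewrite ltr_pM2l.
  - by move=> x _; rewrite D; exact: cvg_cst.
  - by rewrite D; exact: is_cvg_cst.
  - by rewrite D; exact: is_cvg_cst.
  - split.
    + by move=> x _; exact: derivableM.
    + by apply: cvg_at_right_filter; exact: mulrl_continuous.
    + by apply: cvg_at_left_filter; exact: mulrl_continuous.
  - apply: continuous_in_subspaceT => x /set_mem/=; rewrite in_itv/= => /andP[h _].
    apply: cG; rewrite in_itv/= andbT; apply: lt_le_trans h.
    by rewrite divr_gt0.
apply: h2.
- apply/measurable_EFinP => /=; exact: measurable_funM.
- by move=> x x0; rewrite -EFinM lee_fin mulr_ge0 ?G0 ?mulr_gt0 ?ltW.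
Qed.

(** * The Gamma integral: finiteness, functional equation, positivity, rescaling *)

Definition gamma_kernel {R : realType} (s t : R) : R :=
  powR t (s - 1) * expR (- t).

Lemma gamma_kernel_ge0 {R : realType} (s t : R) : 0 <= gamma_kernel s t.
Proof. by rewrite mulr_ge0// ?powR_ge0 ?expR_ge0. Qed.

Lemma measurable_gamma_kernel {R : realType} (s : R) (D : set R) :
  measurable_fun D (gamma_kernel s).
Proof.
apply: measurable_funTS; apply: measurable_funM.
  exact: measurable_powR.
by apply: measurableT_comp => //; exact: measurable_expR.
Qed.

(** With y = x/(2s), the bound y <= 1 + y <= exp y gives x <= 2s exp(x/(2s)); raising to the power s
    and multiplying by exp(-x) gives the claim. Half of the exponential decay is kept, which yields
    both an integrable majorant and the limit at infinity. *)
Lemma powR_expRN_le {R : realType} (s x : R) : 0 < s -> 0 <= x ->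
  x `^ s * expR (- x) <= (2 * s) `^ s * expR (- (x / 2)).
Proof.
move=> s0 x0.
have s20 : 0 < 2 * s by rewrite mulr_gt0.
have -> : expR (- (x / 2)) = expR (x / 2) * expR (- x).
  by rewrite -expRD; congr expR; lra.
rewrite mulrA ler_wpM2r ?expR_ge0//.
have -> : expR (x / 2) = expR (x / (2 * s)) `^ s.
  by rewrite -expRM; congr expR; field; rewrite gt_eqF.
rewrite -powRM ?expR_ge0 ?(ltW s20)//.
apply: (ge0_ler_powR (ltW s0)); rewrite ?nnegrE ?mulr_ge0 ?expR_ge0 ?(ltW s0)//.
rewrite -ler_pdivrMl// mulrC; apply: le_trans (expR_ge1Dx _).
by rewrite lerDr.
Qed.

Lemma cvg_expRN_half {R : realType} : expR (- (x / 2)) @[x --> +oo] --> (0 : R).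
Proof.
apply: (@cvg_comp _ _ _ (fun x : R => x / 2) (fun x => expR (- x)) _ +oo).
  exact: gt0_cvgMly.
exact: cvgr_expR.
Qed.

Lemma integral_expRN_half {R : realType} :
  (\int[@lebesgue_measure R]_(x in `]0%R, +oo[) (expR (- (x / 2)))%:E = 2%:E)%E.
Proof.
have D (x : R) : is_derive x 1 (fun x : R => - 2 * expR (- (x / 2))) (expR (- (x / 2))).
  apply: is_derive_eq.
  by rewrite /GRing.scale/=; lra.
have cF (x : R) : {for x, continuous (fun x : R => - 2 * expR (- (x / 2)))}.
  apply/differentiable_continuous/derivable1_diffP; apply: ex_derive.
have ce (x : R) : {for x, continuous (fun x : R => expR (- (x / 2)))}.
  apply/differentiable_continuous/derivable1_diffP; apply: ex_derive.
rewrite integral_itv_obnd_cbnd; last first.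
  apply/measurable_EFinP/measurable_funTS; apply: continuous_measurable_fun; exact: ce.
rewrite (@ge0_continuous_FTC2y _ _ (fun x => - 2 * expR (- (x / 2))) 0 0)//.
- by rewrite mul0r oppr0 expR0 mulr1 -EFinB sub0r opprK.
- by apply: continuous_subspaceT.
- rewrite -(mulr0 (- 2)); apply: cvgMr; exact: cvg_expRN_half.
- by apply: cvg_at_right_filter; exact: cF.
- by move=> x _; rewrite derive1E derive_val.
Qed.

Lemma cvg_powR_expRN {R : realType} (s : R) : 0 < s ->
  x `^ s * expR (- x) @[x --> +oo] --> (0 : R).
Proof.
move=> s0.
apply: (@squeeze_cvgr _ _ _ _ (fun=> 0) (fun x => (2 * s) `^ s * expR (- (x / 2)))).
- near=> x; rewrite mulr_ge0 ?powR_ge0 ?expR_ge0//=.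
  by apply: powR_expRN_le => //; near: x; exact: nbhs_pinfty_ge.
- exact: cvg_cst.
- rewrite -(mulr0 ((2 * s) `^ s)); apply: cvgMr; exact: cvg_expRN_half.
Unshelve. all: by end_near. Qed.

Lemma continuous_gamma_kernel {R : realType} (s : R) :
  {in `]0, +oo[, continuous (gamma_kernel s)}.
Proof.
move=> x; rewrite in_itv/= andbT => x0.
apply/differentiable_continuous/derivable1_diffP.
apply: derivableM.
  by apply: derivable_powR; rewrite in_itv/= andbT.
by apply: ex_derive.
Qed.

(** Integration by parts with x^s and -exp(-x) on [1/(n+2), n+2], then n to infinity. The identity
    is stated in the extended reals, before finiteness is known, because finiteness is deduced from
    it. *)
Lemma integral_gamma_kernelS {R : realType} (s : R) : 0 < s ->
  (\int[@lebesgue_measure R]_(x in `]0%R, +oo[) (gamma_kernel (s + 1) x)%:E =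
   s%:E * \int[@lebesgue_measure R]_(x in `]0%R, +oo[) (gamma_kernel s x)%:E)%E.
Proof.
move=> s0.
pose F (x : R) := x `^ s.
pose G (x : R) := - expR (- x).
pose a n : R := 1 / n.+2%:R.
pose b n : R := 1 * n.+2%:R.
have cI r : (\int[@lebesgue_measure R]_(x in `[(1 / n.+2%:R)%R, (1 * n.+2%:R)%R])
    (gamma_kernel r x)%:E)%E @[n --> \oo] -->
    (\int[@lebesgue_measure R]_(x in `]0%R, +oo[) (gamma_kernel r x)%:E)%E.
  apply: cvg_integral_itv0y => //.
    by apply/measurable_EFinP; exact: measurable_gamma_kernel.
  by move=> x _; rewrite lee_fin gamma_kernel_ge0.
have E : (fun n => \int[@lebesgue_measure R]_(x in
      `[(1 / n.+2%:R)%R, (1 * n.+2%:R)%R]) (gamma_kernel (s + 1) x)%:E)%E =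
    (fun n => (F (b n) * G (b n) - F (a n) * G (a n))%:E +
      s%:E * \int[@lebesgue_measure R]_(x in
        `[(1 / n.+2%:R)%R, (1 * n.+2%:R)%R]) (gamma_kernel s x)%:E)%E.
  apply/funext => n.
  have a0 : 0 < a n by rewrite divr_gt0.
  have ab : a n < b n.
    by rewrite /a /b !mul1r (@lt_trans _ _ 1) ?invf_lt1 ?ltr1n.
  have pos (x : R) : x \in `[a n, b n] -> 0 < x.
    by rewrite in_itv/= => /andP[h _]; exact: lt_le_trans h.
  have dF (x : R) : 0 < x -> is_derive x 1 F (s * x `^ (s - 1)).
    exact: is_derive1_powR.
  have dG (x : R) : is_derive x 1 G (expR (- x)).
    by apply: is_derive_eq; rewrite /GRing.scale/=; lra.
  have cF (x : R) : 0 < x -> {for x, continuous F}.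
    move=> x0; apply/differentiable_continuous/derivable1_diffP.
    by apply: ex_derive; exact: dF.
  have cG (x : R) : {for x, continuous G}.
    apply/differentiable_continuous/derivable1_diffP.
    by apply: ex_derive; exact: dG.
  have ce (x : R) : {for x, continuous (fun x : R => expR (- x))}.
    apply/differentiable_continuous/derivable1_diffP.
    by apply: ex_derive.
  have oo (x : R) : x \in `]a n, b n[ -> 0 < x.
    by move=> h; apply: pos; exact: subset_itv_oo_cc.
  have parts := @integration_by_parts R F G (fun x => s * x `^ (s - 1))
    (fun x => expR (- x)) _ _ ab.
  transitivity (\int[@lebesgue_measure R]_(x in `[a n, b n]) (F x * expR (- x))%:E)%E.
    by apply: eq_integral => x _; rewrite /gamma_kernel addrK.
  rewrite parts; last 6 first.
  - apply: continuous_in_subspaceT => x /set_mem/= /pos x0.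
    apply/differentiable_continuous/derivable1_diffP/derivableM => //.
    by apply: derivable_powR; rewrite in_itv/= andbT.
  - split.
    + by move=> x /oo x0; apply: ex_derive; exact: dF.
    + by apply: cvg_at_right_filter; exact: cF.
    + by apply: cvg_at_left_filter; apply: cF; exact: lt_trans ab.
  - by move=> x /oo x0; rewrite derive1E; case: (dF _ x0).
  - exact: continuous_subspaceT.
  - split.
    + by move=> x _; apply: ex_derive; exact: dG.
    + by apply: cvg_at_right_filter; exact: cG.
    + by apply: cvg_at_left_filter; exact: cG.
  - by move=> x _; rewrite derive1E; case: (dG x).
  congr (_ + _)%E; rewrite -ge0_integralZl_EFin//=; last 3 first.
  - by move=> x _; rewrite lee_fin gamma_kernel_ge0.
  - by apply/measurable_EFinP; exact: measurable_gamma_kernel.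
  - exact: ltW.
  (* The integrand is nonpositive, so its positive part integrates to 0 and the sign can be moved
     through the integral. *)
  rewrite -integralN/=; last first.
    apply: fin_num_adde_defr; rewrite integral0_eq// => x xab.
    rewrite (@le0_funeposE _ _ `[a n, b n]%classic) ?inE// => y /= _.
    by rewrite lee_fin /G mulrN oppr_le0 !mulr_ge0 ?powR_ge0 ?expR_ge0 ?ltW.
  apply: eq_integral => x _; rewrite -EFinM; congr EFin.
  by rewrite /G /gamma_kernel mulrN opprK mulrA.
(* The boundary terms tend to the finite value 0, so the limit of the sum is the sum of the limits
   even if the remaining integral is infinite. *)
suff h : ((F (b n) * G (b n) - F (a n) * G (a n))%:E + s%:E *
    \int[@lebesgue_measure R]_(x in `[(1 / n.+2%:R)%R, (1 * n.+2%:R)%R])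
      (gamma_kernel s x)%:E)%E @[n --> \oo] -->
    (0 + s%:E * \int[@lebesgue_measure R]_(x in `]0%R, +oo[) (gamma_kernel s x)%:E)%E.
  by rewrite add0e in h; apply: (cvg_unique (@ereal_hausdorff R) (cI _)); rewrite E.
apply: cvgeD.
- by rewrite fin_num_adde_defr.
- apply: cvg_EFin; first by near=> n.
  rewrite (_ : _ \o _ = fun n => F (b n) * G (b n) - F (a n) * G (a n))//.
  have bE : b = fun n => n.+2%:R by apply/funext => n; rewrite /b mul1r.
  have cb : b n @[n --> \oo] --> +oo.
    rewrite bE; apply/cvgryPge => A; near=> n.
    apply: (@le_trans _ _ n%:R); last by rewrite ler_nat -addn2 leq_addr.
    by near: n; exact: nbhs_infty_ger.
  have cb' (M : R) : \forall n \near \oo, M < n.+2%:R.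
    by move: M; apply/cvgryPgt; rewrite -bE.
  (* The left endpoint tends to 0 through positive values, which is the mode of convergence for
     which x^s tends to 0. The factor -exp(-x) stays bounded there, whereas at the right endpoint
     its decay beats x^s. *)
  have ca : a n @[n --> \oo] --> 0^'+.
    move=> A [e /= e0 eA]; change (\forall n \near \oo, A (a n)).
    near=> n; apply: eA => /=; last by rewrite /a divr_gt0.
    rewrite sub0r normrN /a gtr0_norm ?divr_gt0// div1r invf_plt ?posrE//.
    by near: n; exact: cb'.
  have h1 : F (b n) * G (b n) @[n --> \oo] --> - 0.
    rewrite /F /G; under eq_fun do rewrite mulrN.
    apply: cvgN; exact: (cvg_comp _ _ cb (cvg_powR_expRN _ s0)).
  have h2 : F (a n) * G (a n) @[n --> \oo] --> 0 * G 0.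
    have h3 : F (a n) @[n --> \oo] --> 0 by exact: (cvg_comp _ _ ca (powR_cvg0 s0)).
    apply: cvgM => //.
    have cG0 : G x @[x --> 0^'+] --> G 0.
      have cG : {for (0 : R), continuous G}.
        by apply/differentiable_continuous/derivable1_diffP; apply: ex_derive.
      by apply: cvg_at_right_filter; exact: cG.
    exact: (cvg_comp _ _ ca cG0).
  rewrite -[X in _ --> X](_ : - 0 - 0 * G 0 = 0); last by rewrite oppr0 mul0r subrr.
  exact: cvgB.
- by apply: cvgeZl.
Unshelve. all: by end_near. Qed.

(** The exponential majorant settles the exponent s + 1, whose kernel x^s exp(-x) is bounded near 0.
    The functional equation then transfers finiteness down to s, which covers the singular case s <
    1 without a separate estimate at 0. *)
Lemma integral_gamma_kernel_lty {R : realType} (s : R) : 0 < s ->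
  (\int[@lebesgue_measure R]_(x in `]0%R, +oo[) (gamma_kernel s x)%:E < +oo)%E.
Proof.
move=> s0.
have : (\int[@lebesgue_measure R]_(x in `]0%R, +oo[) (gamma_kernel (s + 1) x)%:E
    < +oo)%E.
  apply: (@le_lt_trans _ _ (\int[@lebesgue_measure R]_(x in `]0%R, +oo[)
     (((2 * s) `^ s)%:E * (expR (- (x / 2)))%:E))%E).
    apply: ge0_le_integral => //=.
    - by move=> x _; rewrite lee_fin gamma_kernel_ge0.
    - by apply/measurable_EFinP; exact: measurable_gamma_kernel.
    - apply/measurable_EFinP; apply: measurable_funTS => /=.
      apply: measurable_funM => //; apply: measurableT_comp.
        exact: measurable_expR.
      by apply: measurableT_comp => //; exact: measurable_funM.
    - move=> x; rewrite in_itv/= andbT => x0; rewrite -EFinM lee_fin.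
      by rewrite /gamma_kernel addrK powR_expRN_le// ltW.
  rewrite ge0_integralZl_EFin ?powR_ge0//=; last first.
    apply/measurable_EFinP; apply: measurable_funTS => /=; apply: measurableT_comp.
      exact: measurable_expR.
    by apply: measurableT_comp => //; exact: measurable_funM.
  by rewrite integral_expRN_half -EFinM ltry.
rewrite integral_gamma_kernelS//.
have : (0 <= \int[@lebesgue_measure R]_(x in `]0%R, +oo[) (gamma_kernel s x)%:E)%E.
  by apply: integral_ge0 => x _; rewrite lee_fin gamma_kernel_ge0.
case: (\int[_]_(x in _) _)%E => [r| |]//= _; rewrite ?ltry//.
(* An infinite integral at s would make s times it infinite, against the bound at s + 1. *)
by rewrite gt0_muley ?lte_fin.
Qed.

(** [Rintegral] sends an infinite integral to the default value 0; finiteness excludes this, so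
    [Gamma] can be exchanged for the extended integral. *)
Lemma EFin_Gamma {R : realType} (s : R) : 0 < s ->
  ((Gamma s)%:E =
   \int[@lebesgue_measure R]_(x in `]0%R, +oo[) (gamma_kernel s x)%:E)%E.
Proof.
move=> s0; rewrite /Gamma /Rintegral fineK// ge0_fin_numE.
  exact: integral_gamma_kernel_lty.
by apply: integral_ge0 => x _; rewrite lee_fin gamma_kernel_ge0.
Qed.

Lemma GammaD1 {R : realType} (s : R) : 0 < s -> Gamma (s + 1) = s * Gamma s.
Proof.
move=> s0; apply: EFin_inj.
by rewrite EFinM !EFin_Gamma ?addr_gt0// integral_gamma_kernelS.
Qed.

Lemma Gamma_gt0 {R : realType} (s : R) : 0 < s -> 0 < Gamma s.
Proof.
move=> s0; rewrite -lte_fin EFin_Gamma//.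
(* A lower bound of the kernel on [1, 2]: there 0 <= ln x <= 1, so (s - 1) ln x >= -|s - 1|, and -x
   >= -2. *)
pose m : R := expR (- (`|s - 1| + 2)).
apply: (@lt_le_trans _ _ (\int[@lebesgue_measure R]_(x in `[1%R, 2%R]) (cst m%:E x))%E).
  rewrite integral_cst//= lebesgue_measure_itv/= lte_fin ltr1n.
  by rewrite -EFinB -EFinM lte_fin mulr_gt0 ?expR_gt0//; lra.
apply: (@le_trans _ _ (\int[@lebesgue_measure R]_(x in `[1%R, 2%R])
  (gamma_kernel s x)%:E)%E).
  apply: ge0_le_integral => //=.
  - by move=> x _; rewrite lee_fin expR_ge0.
  - by apply/measurable_EFinP; exact: measurable_gamma_kernel.
  - move=> x; rewrite in_itv/= => /andP[x1 x2]; rewrite lee_fin.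
    have x0 : 0 < x by apply: lt_le_trans x1.
    rewrite /gamma_kernel /powR gt_eqF// -expRD ler_expR.
    have lx0 : 0 <= ln x by rewrite ln_ge0.
    have lx1 : ln x <= 1.
      by have := @le_ln1Dx R (x - 1); rewrite addrCA subrr addr0 => h; lra.
    have : `|(s - 1) * ln x| <= `|s - 1|.
      by rewrite normrM (ger0_norm lx0) ler_piMr.
    by rewrite ler_norml => /andP[h _]; lra.
apply: ge0_subset_integral => //=.
- by apply/measurable_EFinP; exact: measurable_gamma_kernel.
- by move=> x _; rewrite lee_fin gamma_kernel_ge0.
- by move=> x /=; rewrite !in_itv/= andbT => /andP[h _]; exact: lt_le_trans h.
Qed.

(** Substituting x = c t in the Gamma integral produces the factor c from dx and c^(s-1) from the
    power, hence c^s in total. *)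
Lemma integral_powR_expRM {R : realType} (s c : R) : 0 < s -> 0 < c ->
  (\int[@lebesgue_measure R]_(t in `]0%R, +oo[)
     (t `^ (s - 1) * expR (- (c * t)))%:E = (Gamma s * c `^ (- s))%:E)%E.
Proof.
move=> s0 c0.
have mk : measurable_fun `](0 : R), +oo[ (fun t : R => t `^ (s - 1) * expR (- (c * t))).
  apply: measurable_funTS; apply: measurable_funM; first exact: measurable_powR.
  apply: measurableT_comp; first exact: measurable_expR.
  by apply: measurableT_comp => //; exact: measurable_funM.
have := ge0_integral_itv0y_scale c (gamma_kernel s) c0 (continuous_gamma_kernel s)
  (fun x _ => gamma_kernel_ge0 s x).
rewrite -EFin_Gamma//.
rewrite (_ : (\int[_]_(x in _) _)%E = ((c `^ (s - 1))%:E *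
  \int[@lebesgue_measure R]_(t in `]0%R, +oo[)
     (t `^ (s - 1) * expR (- (c * t)))%:E)%E); last first.
  rewrite -ge0_integralZl_EFin//=; last 3 first.
  - by move=> x _; rewrite lee_fin mulr_ge0 ?powR_ge0 ?expR_ge0.
  - exact/measurable_EFinP.
  - exact: powR_ge0.
  apply: eq_integral => x; rewrite inE/= in_itv/= andbT => x0.
  by rewrite -EFinM /gamma_kernel powRM ?ltW// mulrA.
rewrite muleA -EFinM mulr_powRB1 ?(ltW c0)// => h.
have cs0 : c `^ s != 0 by rewrite gt_eqF ?powR_gt0.
by rewrite mulrC powRN EFinM h muleA -EFinM mulVf// mul1e.
Qed.

(** * Real and extended series, and the negative binomial series *)

Lemma nneseries_EFin {R : realType} (u : R^nat) (l : R) :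
  series u @ \oo --> l -> (\sum_(0 <= k <oo) (u k)%:E = l%:E)%E.
Proof.
move=> ul; apply/cvg_lim => //.
rewrite (_ : (fun n => (\sum_(0 <= k < n) (u k)%:E)%E) = EFin \o series u).
  by apply: cvg_EFin => //; near=> n.
by apply/funext => n; rewrite /= sumEFin.
Unshelve. all: by end_near. Qed.

(** Nonnegative terms make the extended partial sums converge, so the infinite sum is a genuine
    limit; since it is finite, convergence descends to the reals. *)
Lemma cvg_series_EFin {R : realType} (u : R^nat) (l : R) :
  (forall k, 0 <= u k) -> (\sum_(0 <= k <oo) (u k)%:E = l%:E)%E ->
  series u @ \oo --> l.
Proof.
move=> u0 ul.
have : (\sum_(0 <= k < n) (u k)%:E)%E @[n --> \oo] --> l%:E.
  by rewrite -ul; apply: is_cvg_nneseries => n _ _; rewrite lee_fin.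
rewrite (_ : (fun n => (\sum_(0 <= k < n) (u k)%:E)%E) = EFin \o series u).
  by move/fine_cvgP => [].
by apply/funext => n; rewrite /= sumEFin.
Qed.

(* Expand [Gamma (k + p)] as an integral and sum the exponential series under
   the integral sign. *)
Lemma negative_binomial_series {R : realType} (p g a : R) :
  0 < p -> 0 < g -> 0 < a ->
  (\sum_(0 <= k <oo) (Gamma (k%:R + p) / k`!%:R * g ^+ k *
     (a + g) `^ (- (k%:R + p)))%:E = (Gamma p * a `^ (- p))%:E)%E.
Proof.
move=> p0 g0 a0.
(* Summing over k turns the last factor into exp(g t), which cancels the g part of exp(-(a + g) t)
   and leaves the Gamma integral at rate a. *)
pose f k (t : R) : R := t `^ (p - 1) * expR (- ((a + g) * t)) * exp_coeff (g * t) k.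
have mf k : measurable_fun `](0 : R), +oo[ (EFin \o f k).
  apply/measurable_EFinP; apply: measurable_funTS; apply: measurable_funM.
    apply: measurable_funM; first exact: measurable_powR.
    apply: measurableT_comp; first exact: measurable_expR.
    by apply: measurableT_comp => //; exact: measurable_funM.
  rewrite /exp_coeff; apply: measurable_funM => //.
  by apply: measurable_funX; exact: measurable_funM.
have f0 k t : `](0 : R), +oo[%classic t -> (0 <= (f k t)%:E)%E.
  rewrite /= in_itv/= andbT => t0; rewrite lee_fin.
  apply: mulr_ge0; first by rewrite mulr_ge0 ?powR_ge0 ?expR_ge0.
  by apply: exp_coeff_ge0; rewrite mulr_ge0 ?ltW.
transitivity (\sum_(0 <= k <oo)
  \int[@lebesgue_measure R]_(t in `]0%R, +oo[) (f k t)%:E)%E.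
  apply: eq_eseriesr => k _.
  have kp0 : 0 < k%:R + p by rewrite ltr_wpDl.
  rewrite (_ : _ * _ = g ^+ k / k`!%:R *
      (Gamma (k%:R + p) * (a + g) `^ (- (k%:R + p)))); last by ring.
  rewrite EFinM -integral_powR_expRM ?(addr_gt0 a0)//.
  rewrite -ge0_integralZl_EFin//=; last 3 first.
  - by move=> t _; rewrite lee_fin mulr_ge0 ?powR_ge0 ?expR_ge0.
  - apply/measurable_EFinP; apply: measurable_funTS; apply: measurable_funM.
      exact: measurable_powR.
    apply: measurableT_comp; first exact: measurable_expR.
    by apply: measurableT_comp => //; exact: measurable_funM.
  - by rewrite divr_ge0// exprn_ge0 ?ltW.
  apply: eq_integral => t; rewrite inE/= in_itv/= andbT => t0.
  rewrite -EFinM /f /exp_coeff /= exprMn -addrA (@powRD _ t k%:R)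
    ?(gt_eqF t0) ?implybT//.
  by rewrite powR_mulrn ?(ltW t0)//; congr EFin; ring.
rewrite -integral_nneseries//.
rewrite -integral_powR_expRM//.
apply: eq_integral => t; rewrite inE/= in_itv/= andbT => t0.
under eq_eseriesr do rewrite EFinM.
rewrite nneseriesZl//; last first.
  by move=> k _; rewrite lee_fin exp_coeff_ge0// mulr_ge0 ?ltW.
rewrite (@nneseries_EFin _ _ (expR (g * t))); last exact: is_cvg_series_exp_coeff.
rewrite -EFinM -mulrA -expRD; congr (_ * expR _)%:E.
by ring.
Qed.

(** * The weights as mixtures, and their total mass *)

Lemma alpha_ge0 {R : realType} (d : nat) (nu gam : R) (k : nat) :
  (0 < d)%N -> 0 < nu -> 0 <= alpha d nu gam k.
Proof.
move=> d0 nu0.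
have p0 : 0 < d%:R / 2 :> R by rewrite divr_gt0 ?ltr0n.
apply: mulr_ge0.
  apply: mulr_ge0; last by rewrite mulnC exprM sqr_ge0.
  rewrite divr_ge0// ?mulr_ge0// ltW// Gamma_gt0//.
  by rewrite ltr_wpDl.
by apply: Rintegral_ge0 => x _; rewrite !mulr_ge0 ?expR_ge0 ?powR_ge0.
Qed.

Lemma measurable_alpha_kernel {R : realType} (s g r : R) (D : set R) :
  measurable_fun D (fun a : R => expR (- a) * a `^ s * (a + g) `^ r).
Proof.
apply: measurable_funTS; apply: measurable_funM.
  apply: measurable_funM; last exact: measurable_powR.
  by apply: measurableT_comp => //; exact: measurable_expR.
apply: (@measurableT_comp _ _ _ _ _ _ (fun x : R => x `^ r) _ (fun x : R => x + g)).
  exact: measurable_powR.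
exact: measurable_funD.
Qed.

(** The integrand is split into a factor free of k and the k-th term of the negative binomial
    series, ready for summation under the integral. *)
Lemma EFin_alpha {R : realType} (d : nat) (nu gam : R) (k : nat) :
  (0 < d)%N -> 0 < nu -> 0 < gam ->
  ((alpha d nu gam k)%:E =
   \int[@lebesgue_measure R]_(a in `]0%R, +oo[)
    ((expR (- a) * a `^ (nu + d%:R / 2 - 1) / (Gamma (d%:R / 2) * Gamma nu))%:E *
     (Gamma (k%:R + d%:R / 2) / k`!%:R * (gam ^+ 2) ^+ k *
      (a + gam ^+ 2) `^ (- (k%:R + d%:R / 2)))%:E))%E.
Proof.
move=> d0 nu0 gam0.
have p0 : 0 < d%:R / 2 :> R by rewrite divr_gt0 ?ltr0n.
have kp0 : 0 < k%:R + d%:R / 2 :> R by rewrite ltr_wpDl.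
have g0 : 0 < gam ^+ 2 by rewrite exprn_gt0.
have mk := measurable_alpha_kernel (nu + d%:R / 2 - 1) (gam ^+ 2)
  (- (k%:R + d%:R / 2)) `](0 : R), +oo[.
have k0 (a : R) : 0 <= expR (- a) * a `^ (nu + d%:R / 2 - 1) *
    (a + gam ^+ 2) `^ (- (k%:R + d%:R / 2)).
  by rewrite !mulr_ge0 ?expR_ge0 ?powR_ge0.
rewrite /alpha EFinM /Rintegral fineK; last first.
  rewrite ge0_fin_numE; last by apply: integral_ge0 => a _; rewrite lee_fin.
  (* Since a + gam^2 >= gam^2 and the exponent is negative, the integrand is at most a constant
     times the Gamma kernel of parameter nu + d/2. *)
  apply: (@le_lt_trans _ _ (\int[@lebesgue_measure R]_(a in `]0%R, +oo[)
      (((gam ^+ 2) `^ (- (k%:R + d%:R / 2)))%:E *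
       (gamma_kernel (nu + d%:R / 2) a)%:E))%E).
    apply: ge0_le_integral => //=.
    - by move=> a _; rewrite lee_fin.
    - exact/measurable_EFinP.
    - apply/measurable_EFinP; apply: measurable_funM => //.
      exact: measurable_gamma_kernel.
    - move=> a; rewrite in_itv/= andbT => a0; rewrite lee_fin mulrC.
      rewrite /gamma_kernel (mulrC (expR _)) ler_wpM2r//.
        by rewrite mulr_ge0 ?expR_ge0 ?powR_ge0.
      rewrite !powRN lef_pV2 ?posrE ?powR_gt0 ?(addr_gt0 a0)//.
      apply: (ge0_ler_powR (ltW kp0)); rewrite ?nnegrE ?(ltW g0)//.
        exact: ltW (addr_gt0 a0 g0).
      by rewrite lerDr ltW.
  rewrite ge0_integralZl_EFin ?powR_ge0//=; last 2 first.
  - by move=> a _; rewrite lee_fin gamma_kernel_ge0.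
  - by apply/measurable_EFinP; exact: measurable_gamma_kernel.
  by rewrite -EFin_Gamma ?addr_gt0// -EFinM ltry.
rewrite -ge0_integralZl_EFin//=; last 3 first.
- by move=> a _; rewrite lee_fin.
- exact/measurable_EFinP.
- apply: mulr_ge0; last by rewrite mulnC exprM sqr_ge0.
  by rewrite divr_ge0// ?mulr_ge0// ltW// Gamma_gt0.
apply: eq_integral => a _; rewrite -!EFinM; congr EFin.
rewrite -exprM mulnC.
have h1 := Gamma_gt0 _ p0; have h2 := Gamma_gt0 _ nu0.
have h3 : (0 : R) < k`!%:R by rewrite ltr0n fact_gt0.
by field; rewrite !gt_eqF.
Qed.

Lemma cvg_series_alpha {R : realType} (d : nat) (nu gam : R) :
  (0 < d)%N -> 0 < nu -> 0 < gam -> series (alpha d nu gam) @ \oo --> (1 : R).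
Proof.
move=> d0 nu0 gam0.
have p0 : 0 < d%:R / 2 :> R by rewrite divr_gt0 ?ltr0n.
have g0 : 0 < gam ^+ 2 by rewrite exprn_gt0.
have Gp := Gamma_gt0 _ p0; have Gnu := Gamma_gt0 _ nu0.
apply: cvg_series_EFin => [k|]; first exact: alpha_ge0.
have c0 (a : R) : 0 <= expR (- a) * a `^ (nu + d%:R / 2 - 1) /
    (Gamma (d%:R / 2) * Gamma nu).
  by apply: divr_ge0; rewrite mulr_ge0 ?expR_ge0 ?powR_ge0 ?(ltW Gp) ?(ltW Gnu).
have w0 k (a : R) : 0 <= Gamma (k%:R + d%:R / 2) / k`!%:R * (gam ^+ 2) ^+ k *
      (a + gam ^+ 2) `^ (- (k%:R + d%:R / 2)).
  have Gk : 0 < Gamma (k%:R + d%:R / 2 : R) by apply: Gamma_gt0; rewrite ltr_wpDl.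
  apply: mulr_ge0; last exact: powR_ge0.
  apply: mulr_ge0; first by rewrite divr_ge0 ?(ltW Gk).
  by rewrite exprn_ge0 ?(ltW g0).
under eq_eseriesr do rewrite EFin_alpha//.
rewrite -integral_nneseries//=; last 2 first.
- move=> k; apply: emeasurable_funM; apply/measurable_EFinP; apply: measurable_funTS.
    apply: measurable_funM => //; apply: measurable_funM; last exact: measurable_powR.
    by apply: measurableT_comp => //; exact: measurable_expR.
  apply: measurable_funM => //.
  apply: (@measurableT_comp _ _ _ _ _ _ (fun x : R => x `^ _) _
    (fun x : R => x + gam ^+ 2)).
    exact: measurable_powR.
  exact: measurable_funD.
- by move=> k a _; rewrite -EFinM lee_fin mulr_ge0.
(* The inner series contributes Gamma(d/2) a^(-d/2), so what remains is the Gamma(nu) density, of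
   integral 1. *)
transitivity (\int[@lebesgue_measure R]_(a in `]0%R, +oo[)
    ((Gamma nu)^-1%:E * (gamma_kernel nu a)%:E))%E.
  apply: eq_integral => a; rewrite inE/= in_itv/= andbT => a0.
  rewrite nneseriesZl; last by move=> k _; rewrite lee_fin.
  rewrite negative_binomial_series// -!EFinM; congr EFin.
  rewrite /gamma_kernel addrAC (@powRD _ a (nu - 1)) ?(gt_eqF a0) ?implybT// powRN.
  have ap : 0 < a `^ (d%:R / 2) by rewrite powR_gt0.
  by field; rewrite !gt_eqF.
rewrite ge0_integralZl_EFin ?invr_ge0 ?(ltW Gnu)//=; last 2 first.
- by move=> a _; rewrite lee_fin gamma_kernel_ge0.
- by apply/measurable_EFinP; exact: measurable_gamma_kernel.
by rewrite -EFin_Gamma// -EFinM mulVf ?gt_eqF.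
Qed.

(** * The parameter shift and the moments *)

(** Passing from (k+1, d, nu) to (k, d+2, nu-1) preserves both nu + d/2 and k + d/2, so the two
    integrals are identical. Only the prefactors differ, by the functional equation of [Gamma] at
    d/2 and at nu - 1; the latter uses nu > 1. *)
Lemma alphaS {R : realType} (d : nat) (nu gam : R) (k : nat) :
  (0 < d)%N -> 1 < nu ->
  k.+1%:R * alpha d nu gam k.+1 =
  d%:R / 2 * gam ^+ 2 / (nu - 1) * alpha d.+2 (nu - 1) gam k.
Proof.
move=> d0 nu1.
have p0 : 0 < d%:R / 2 :> R by rewrite divr_gt0 ?ltr0n.
have nu0 : 0 < nu - 1 by rewrite subr_gt0.
have pE : d.+2%:R / 2 = d%:R / 2 + 1 :> R by rewrite -addn2 natrD; field.
have kE : k.+1%:R + d%:R / 2 = k%:R + (d%:R / 2 + 1) :> R.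
  by rewrite -addn1 natrD; ring.
have nuE : nu - 1 + (d%:R / 2 + 1) - 1 = nu + d%:R / 2 - 1 by ring.
rewrite /alpha pE kE nuE GammaD1//.
have -> : Gamma nu = (nu - 1) * Gamma (nu - 1) by rewrite -GammaD1// subrK.
have hp := Gamma_gt0 _ p0; have hnu := Gamma_gt0 _ nu0.
have hk : (0 : R) < k`!%:R by rewrite ltr0n fact_gt0.
have hk1 : (0 : R) < k.+1%:R by rewrite ltr0n.
rewrite factS natrM mulnS exprD.
(* The common integral and the common Gamma factor become atoms, leaving a rational identity. *)
move: (Rintegral _ _ _) (Gamma (k%:R + _)) => I G.
rewrite -natr1 in hk1 *.
have hd : (0 : R) < d%:R by rewrite ltr0n.
by field; rewrite !gt_eqF.
Qed.

(** As the first term vanishes, the partial sum of [u] with n + 1 terms is c times that of [v] with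
    n terms. *)
Lemma cvg_series_shift {R : realType} (u v : R^nat) (c l : R) :
  u 0%N = 0 -> (forall k, u k.+1 = c * v k) -> series v @ \oo --> l ->
  series u @ \oo --> c * l.
Proof.
move=> u0 uS vl.
rewrite -(cvg_shiftS (series u)).
rewrite (_ : (fun n => series u n.+1) = (fun n => c * series v n)).
  exact: cvgMr.
apply/funext => n; rewrite /series/= big_nat_recl// u0 add0r mulr_sumr.
by apply: eq_bigr => k _; rewrite uS.
Qed.

Lemma cvg_series_mean {R : realType} (d : nat) (nu gam : R) :
  (0 < d)%N -> 1 < nu -> 0 < gam ->
  series (fun k => k%:R * alpha d nu gam k) @ \oo -->
    d%:R / 2 * gam ^+ 2 / (nu - 1).
Proof.
move=> d0 nu1 gam0; rewrite -[X in _ --> X]mulr1.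
apply: (@cvg_series_shift _ _ (alpha d.+2 (nu - 1) gam)).
- by rewrite mul0r.
- by move=> k; rewrite alphaS.
- by apply: cvg_series_alpha => //; rewrite subr_gt0.
Qed.

(** One shift turns (k+1) k times the weight into a multiple of k times the shifted weight, so the
    series reduces to the mean at (d+2, nu-1). This needs nu - 1 > 1. *)
Lemma cvg_series_factorial_moment2 {R : realType} (d : nat) (nu gam : R) :
  (0 < d)%N -> 2 < nu -> 0 < gam ->
  series (fun k => k%:R * (k%:R - 1) * alpha d nu gam k) @ \oo -->
    d%:R / 2 * gam ^+ 2 / (nu - 1) *
    (d.+2%:R / 2 * gam ^+ 2 / (nu - 1 - 1)).
Proof.
move=> d0 nu2 gam0.
have nu1 : 1 < nu by apply: lt_trans nu2; rewrite ltr1n.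
apply: (@cvg_series_shift _ _ (fun k => k%:R * alpha d.+2 (nu - 1) gam k)).
- by rewrite !mul0r.
- move=> k; rewrite -mulrA mulrCA alphaS// -natr1; ring.
- by apply: cvg_series_mean => //; rewrite ltrBrDr.
Qed.

Theorem theorem7 (R : realType) (d : nat) (nu gam : R) :
  (1 <= d)%N -> 0 < nu -> 0 < gam ->
  [/\ series (alpha d nu gam) @ \oo --> (1 : R),
      1 < nu ->
        series (fun k => k%:R * alpha d nu gam k) @ \oo
          --> (d%:R * gam ^+ 2 / (2 * nu - 2) : R)
    & 2 < nu ->
        series (fun k => (k%:R - d%:R * gam ^+ 2 / (2 * nu - 2)) ^+ 2
                         * alpha d nu gam k) @ \oo
          --> d%:R * gam ^+ 2 / (2 * (nu - 1))
              * (1 + gam ^+ 2 / 2 * ((d%:R + 2 * (nu - 1))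
                                      / ((nu - 1) * (nu - 2))))].
Proof.
move=> d0 nu0 gam0.
have meanE : 1 < nu -> d%:R * gam ^+ 2 / (2 * nu - 2) = d%:R / 2 * gam ^+ 2 / (nu - 1).
  move=> nu1; have h : 0 < nu - 1 by rewrite subr_gt0.
  field; rewrite !gt_eqF//; lra.
split; first exact: cvg_series_alpha.
  by move=> nu1; rewrite meanE//; exact: cvg_series_mean.
move=> nu2.
have nu1 : 1 < nu by apply: lt_trans nu2; rewrite ltr1n.
rewrite meanE//.
set m := d%:R / 2 * gam ^+ 2 / (nu - 1).
have h0 := cvg_series_alpha d nu gam d0 nu0 gam0.
have h1 := cvg_series_mean d nu gam d0 nu1 gam0.
have h2 := cvg_series_factorial_moment2 d nu gam d0 nu2 gam0.
(* The decomposition (k - m)^2 = k(k - 1) + (1 - 2m) k + m^2 writes the variance through the second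
   factorial moment, the mean and the total mass. *)
rewrite [X in _ --> X](_ : _ = m * (d.+2%:R / 2 * gam ^+ 2 / (nu - 1 - 1)) +
  ((1 - 2 * m) * m + m ^+ 2 * 1)); last first.
  rewrite /m -addn2 natrD.
  have k1 : 0 < nu - 1 by rewrite subr_gt0.
  have k2 : 0 < nu - 2 by rewrite subr_gt0.
  by field; rewrite !gt_eqF//; lra.
apply: cvg_trans (cvgD h2 (cvgD (cvgM (cvg_cst (1 - 2 * m)) h1)
  (cvgM (cvg_cst (m ^+ 2)) h0))).
apply: near_eq_cvg; apply: nearW => n /=.
rewrite !fctE /series/= !mulr_sumr -!big_split/=; apply: eq_bigr => k _.
by ring.
Qed.
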